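(* For every positive integer $n$, $$\sqrt{2n}-3\le j(n)\le 2\sqrt{n}+4,$$ where $j(n)$ is the maximum of $j(x)$ over all $x\in c_{00}$ with $x_{n+1}=x_{n+2}=\dots=0$, and $j(x)$ is the least $M$ at which the iterative definition of Tsirelson's norm of $x$ stabilizes.
   Context: $\mathbb{N}$ is the set of positive integers; $c_{00}$ is the space of finitely supported real sequences $x=(x_i)_{i\in\mathbb{N}}$. The Schreier family is $\mathcal{S}_1=\{F\subseteq\mathbb{N}:|F|\le\min F\}$ (with $\emptyset\in\mathcal{S}_1$). For nonempty $E,E'\subseteq\mathbb{N}$, $E<E'$ means $\max E<\min E'$. For $E\subseteq\mathbb{N}$ and $x\in c_{00}$, $Ex$ is the coordinatewise product of $x$ with the characteristic function of $E$. Define $\|x\|_0=\sup_i|x_i|$, and for each integer $m\ge 0$ $$\|x\|_{m+1}=\max\Big\{\|x\|_m,\ \sup\Big\{\tfrac12\sum_{i=1}^d\|E_ix\|_m:\ E_1<\dots<E_d,\ \{\min E_i:1\le i\le d\}\in\mathcal{S}_1\Big\}\Big\},$$ where $d$ ranges over positive integers and the $E_i$ over nonempty finite subsets of $\mathbb{N}$. Tsirelson's norm is $\|x\|_T=\sup_{m\ge0}\|x\|_m$. For every $x\in c_{00}$ there is an $M$ with $\|x\|_M=\|x\|_{M+1}=\dots=\|x\|_T$; $j(x)$ denotes the least such integer $M\ge 0$. *)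

(* Defs.v *)
From HB Require Import structures.
From mathcomp Require Import all_boot all_order all_algebra finmap.
From mathcomp Require Import mathcomp_extra boolp classical_sets reals.

Set Implicit Arguments.
Unset Strict Implicit.
Unset Printing Implicit Defensive.

Import Order.TTheory GRing.Theory Num.Theory.

Local Open Scope fset_scope.
Local Open Scope classical_set_scope.
Local Open Scope ring_scope.

(* The positive integers are represented inside [nat].  A sequence
   (x_i)_(i >= 1) of c_00 is a finitely supported function x on [nat] with
   x 0 = 0; nothing below depends on the value at 0, since the finite subsets
   of the positive integers are the E : {fset nat} with 0 \notin E. *)
Notation c00 R := {fsfun nat -> R with 0%R}.

Definition fmax (E : {fset nat}) : nat := \max_(i <- E) i.

(* [fmax E] only serves as the default value, attained when E is empty. *)
Definition fmin (E : {fset nat}) : nat := \big[minn/fmax E]_(i <- E) i.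

(* The empty set is a member, as [fmin fset0 = 0]. *)
Definition schreier (F : {fset nat}) : bool := (#|` F| <= fmin F)%N.

Definition fset_lt (E E' : {fset nat}) : bool := (fmax E < fmin E')%N.

(* The families E_1 < ... < E_d, d >= 1, of nonempty finite sets of positive
   integers such that {min E_i : 1 <= i <= d} is in the Schreier family. *)
Definition admissible (s : seq {fset nat}) : bool :=
  [&& s != [::],
      all (fun E => (E != fset0) && (0%N \notin E)) s,
      sorted fset_lt s
    & schreier [fset fmin E | E in s]].

Definition restr (R : realType) (E : {fset nat}) (x : c00 R) : c00 R :=
  [fsfun i in E => x i | 0].

(* The sets whose suprema are taken in [tnorm] and [tsirelson] are nonempty
   and bounded above by the l_1 norm of x ([tnorm_l1], [le_tnormS]). *)
Fixpoint tnorm (R : realType) (m : nat) (x : c00 R) : R :=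
  if m is m'.+1 then
    Num.max (tnorm m' x)
      (sup [set 2^-1 * \sum_(E <- s) tnorm m' (restr E x)
             | s in [set s | admissible s]])
  else sup [set `|x i| | i in [set i | (0 < i)%N]].

Definition tsirelson (R : realType) (x : c00 R) : R :=
  sup [set tnorm m x | m in [set: nat]].

Definition stable_from (R : realType) (x : c00 R) (M : nat) : Prop :=
  forall k, (M <= k)%N -> tnorm k x = tsirelson x.

Section Stabilization.
Variable R : realType.
Implicit Types (x : c00 R) (E : {fset nat}) (s : seq {fset nat}).

Lemma restrE E x i : restr E x i = if i \in E then x i else 0.
Proof. by rewrite /restr fsfunE. Qed.

Lemma fmax_ge E i : i \in E -> (i <= fmax E)%N.
Proof. by move=> iE; exact: (@leq_bigmax_seq _ _ xpredT (fun j : nat => j)). Qed.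

Lemma fmin_le E i : i \in E -> (fmin E <= i)%N.
Proof.
rewrite /fmin; move: (fmax E) => d.
have -> : (i \in E) = (i \in (E : seq nat)) by [].
elim: (E : seq nat) => // a r IH; rewrite inE big_cons => /orP[/eqP->|/IH h].
  exact: geq_minl.
by rewrite (leq_trans (geq_minr _ _)).
Qed.

Lemma sorted_pairwise s :
  all (fun E => (E != fset0) && (0%N \notin E)) s -> sorted fset_lt s ->
  pairwise fset_lt s.
Proof.
move=> h; rewrite -(@sorted_pairwise_in _ (fun E => (E != fset0) && (0%N \notin E))) //.
move=> B A C /andP[/fset0Pn[b bB] _] _ _ AB BC.
apply: (leq_trans AB); apply: (leq_trans (fmin_le bB)).
exact: (leq_trans (fmax_ge bB) (ltnW BC)).
Qed.

Lemma pairwise_count s i : pairwise fset_lt s ->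
  (\sum_(E <- s) (i \in E) <= 1)%N.
Proof.
elim: s => [|E s IH]; first by rewrite big_nil.
rewrite pairwise_cons => /andP[/allP Es ps]; rewrite big_cons.
have [iE|_] := boolP (i \in E); last by rewrite add0n IH.
rewrite big_seq big1 // => E' E's; apply/eqP; rewrite eqb0; apply/negP => iE'.
have := Es _ E's; rewrite /fset_lt ltnNge => /negP; apply.
by rewrite (leq_trans (fmin_le iE'))// fmax_ge.
Qed.

Lemma admissible_count s i : admissible s -> (\sum_(E <- s) (i \in E) <= 1)%N.
Proof.
by case/and4P => _ h1 h2 _; apply: pairwise_count; apply: sorted_pairwise.
Qed.

Lemma admissible1 : admissible [:: [fset 1%N]].
Proof.
rewrite /admissible /= andbT -andbA.
have m1 : fmin [fset 1%N] = 1%N.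
  have e1 : [fset 1%N] = [:: 1%N] :> seq nat.
    by apply: perm_small_eq => //; apply: uniq_perm; rewrite ?fset_uniq // => i; rewrite !inE.
  by rewrite /fmin /fmax e1 !big_cons !big_nil.
apply/and3P; split => //.
- by apply/fset0Pn; exists 1%N; rewrite inE.
- by rewrite inE.
have -> : [fset fmin E | E in [:: [fset 1%N]]] = [fset 1%N].
  apply/fsetP => i; rewrite !inE; apply/imfsetP/eqP => /=.
    by move=> [E]; rewrite inE => /eqP -> ->.
  by move=> ->; exists [fset 1%N]; rewrite ?inE ?m1.
by rewrite /schreier cardfs1 m1.
Qed.

Definition l1 x N : R := \sum_(i < N) `|x i|.

Lemma norm_le_l1 x N i : (forall i, (N <= i)%N -> x i = 0) -> `|x i| <= l1 x N.
Proof.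
move=> xN; case: (ltnP i N) => iN; last first.
  by rewrite xN // normr0 sumr_ge0.
by rewrite /l1 (bigD1 (Ordinal iN)) //= lerDl sumr_ge0.
Qed.

Lemma restr_out E x N : (forall i, (N <= i)%N -> x i = 0) ->
  forall i, (N <= i)%N -> restr E x i = 0.
Proof. by move=> xN i /xN xi; rewrite restrE xi if_same. Qed.

Lemma sum_l1 s x N : admissible s ->
  \sum_(E <- s) l1 (restr E x) N <= l1 x N.
Proof.
move=> sA; rewrite /l1 exchange_big /=; apply: ler_sum => i _.
have -> : \sum_(E <- s) `|restr E x i| =
          `|x i| * (\sum_(E <- s) (val i \in E))%N%:R.
  rewrite natr_sum mulr_sumr; apply: eq_bigr => E _.
  by rewrite restrE; case: ifP => _; rewrite ?mulr1 ?normr0 ?mulr0.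
by rewrite ler_piMr // lern1 admissible_count.
Qed.

Lemma c00_bound x : exists N, forall i, (N <= i)%N -> x i = 0.
Proof.
exists (fmax (finsupp x)).+1 => i iN; apply: fsfun_dflt.
by apply/negP => /fmax_ge; rewrite leqNgt iN.
Qed.

Lemma tnorm_l1 m x N :
  (forall i, (N <= i)%N -> x i = 0) -> 0 <= tnorm m x <= l1 x N.
Proof.
elim: m x => [|m IH] x xN /=.
  apply/andP; split; last first.
    apply: ge_sup; first by exists `|x 1%N|, 1%N.
    by move=> _ [i _ <-]; exact: norm_le_l1.
  apply: (le_trans (normr_ge0 (x 1%N))); apply: ub_le_sup; last by exists 1%N.
  by exists (l1 x N) => _ [i _ <-]; exact: norm_le_l1.
have /andP[t0 t1] := IH x xN.
rewrite le_max t0 /= ge_max t1 /=; apply: ge_sup.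
  by eexists; exists [:: [fset 1%N]] => //; exact: admissible1.
move=> _ [s sA <-]; apply: le_trans (sum_l1 x N sA).
apply: (@le_trans _ _ (\sum_(E <- s) tnorm m (restr E x))).
  rewrite ler_piMl ?invf_le1 ?ler1n //; apply: sumr_ge0 => E _.
  by case/andP: (IH _ (restr_out E xN)).
by apply: ler_sum => E _; case/andP: (IH _ (restr_out E xN)).
Qed.

Lemma tnorm_ge0 m x : 0 <= tnorm m x.
Proof. by have [N xN] := c00_bound x; case/andP: (tnorm_l1 m xN). Qed.

Lemma le_tnormS m x s : admissible s ->
  2^-1 * \sum_(E <- s) tnorm m (restr E x) <= tnorm m.+1 x.
Proof.
move=> sA; have [N xN] := c00_bound x.
rewrite /= le_max; apply/orP; right; apply: ub_le_sup; last by exists s.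
exists (l1 x N) => _ [r rA <-]; apply: le_trans (sum_l1 x N rA).
apply: (@le_trans _ _ (\sum_(E <- r) tnorm m (restr E x))).
  rewrite ler_piMl ?invf_le1 ?ler1n //.
  by apply: sumr_ge0 => E _; exact: tnorm_ge0.
by apply: ler_sum => E _; case/andP: (tnorm_l1 m (restr_out E xN)).
Qed.

Lemma tnormS_le m x c : tnorm m x <= c ->
  (forall s, admissible s ->
    2^-1 * \sum_(E <- s) tnorm m (restr E x) <= c) ->
  tnorm m.+1 x <= c.
Proof.
move=> h1 h2; rewrite /= ge_max h1 /=; apply: ge_sup.
  by eexists; exists [:: [fset 1%N]] => //; exact: admissible1.
by move=> _ [s sA <-]; exact: h2.
Qed.

Lemma le_tnorm x m k : (m <= k)%N -> tnorm m x <= tnorm k x.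
Proof.
move=> /subnK <-; elim: (k - m)%N => // d IH.
by rewrite addSn (le_trans IH) //= le_max lexx.
Qed.

Lemma tnorm0 m x : (forall i, x i = 0) -> tnorm m x = 0.
Proof.
move=> x0; apply/eqP; rewrite eq_le tnorm_ge0 andbT.
have /(tnorm_l1 m)/andP[_] : forall i, (0 <= i)%N -> x i = 0 by [].
by rewrite /l1 big_ord0.
Qed.

Lemma restrI E x : restr (finsupp x `&` E)%fset x = restr E x.
Proof.
apply/fsfunP => i; rewrite !restrE inE; have [//|ix] := boolP (i \in finsupp x).
by rewrite (fsfun_dflt ix) /= if_same.
Qed.

Lemma tnorm_eventually x :
  exists M, forall k, (M <= k)%N -> tnorm k x = tnorm M x.
Proof.
have [n] := ubnP #|` finsupp x|; elim: n x => // n IH x xn.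
have /(@choice _ _) [M MP] : forall A : {fset nat}, exists M,
    (A `<` finsupp x)%fset -> forall k, (M <= k)%N ->
    tnorm k (restr A x) = tnorm M (restr A x).
  move=> A; have [Ax|_] := boolP (A `<` finsupp x)%fset; last by exists 0%N.
  have [|M MP] := IH (restr A x); last by exists M.
  rewrite -ltnS; apply: leq_trans xn; rewrite ltnS.
  apply: leq_ltn_trans (fproper_ltn_card Ax); apply: fsubset_leq_card.
  apply/fsubsetP => i; rewrite mem_finsupp restrE.
  by case: ifP => //; rewrite eqxx.
pose K := (\max_(A <- fpowerset (finsupp x)) M A)%N.
have KP E k : ~~ (finsupp x `<=` E)%fset -> (K <= k)%N ->
    tnorm k (restr E x) = tnorm K (restr E x).
  move=> xE Kk; rewrite -restrI; set A := (finsupp x `&` E)%fset.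
  have AP : (A `<` finsupp x)%fset.
    rewrite fproperEneq fsubsetIl andbT; apply: contra xE => /eqP AE.
    by apply/fsetIidPl.
  have MK : (M A <= K)%N.
    by apply: (@leq_bigmax_seq _ _ xpredT M) => //; rewrite fpowersetE fsubsetIl.
  by rewrite (MP A AP k) ?(MP A AP K) // (leq_trans MK).
have step k : (K.+1 <= k)%N -> tnorm k.+1 x <= tnorm k x.
  move=> Kk; apply: tnormS_le => // s sA.
  have [/hasP[E Es xE]|/hasPn sn] := boolP (has (fun E => (finsupp x `<=` E)%fset) s).
    have restr_id : restr E x = x.
      apply/fsfunP => i; rewrite restrE; case: ifP => // iE.
      by rewrite fsfun_dflt //; apply/negP => /(fsubsetP xE); rewrite iE.
    rewrite (big_rem E Es) /= restr_id big1_seq ?addr0.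
      by rewrite ler_piMl ?tnorm_ge0 // invf_le1 ?ler1n.
    move=> E' /= E's; apply: tnorm0 => i; rewrite restrE; case: ifP => // iE'.
    apply: fsfun_dflt; apply/negP => /(fsubsetP xE) iE.
    have := admissible_count i sA.
    by rewrite (big_rem E Es) /= (big_rem E' E's) /= iE iE'.
  apply: le_trans (le_tnorm x Kk); apply: le_trans (le_tnormS K x sA).
  rewrite ler_pM2l ?invr_gt0 ?ltr0n // big_seq [leRHS]big_seq.
  by apply: ler_sum => E Es; rewrite (KP _ _ (sn _ Es)) // ltnW.
exists K.+1 => k /subnK <-; elim: (k - K.+1)%N => // d IHd.
rewrite addSn -IHd; apply/eqP; rewrite eq_le step ?leq_addl //=.
by rewrite le_max lexx.
Qed.

Lemma stable_from_ex x : exists M, `[< stable_from x M >].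
Proof.
have [M MP] := tnorm_eventually x; exists M; apply/asboolP => k Mk.
have le_M m : tnorm m x <= tnorm M x.
  have [mM|/ltnW/MP->//] := leqP m M; exact: le_tnorm.
rewrite MP //; apply/eqP; rewrite eq_le; apply/andP; split.
  by apply: ub_le_sup; [exists (tnorm M x) => _ [m _ <-] | exists M].
by apply: ge_sup; [exists (tnorm M x), M | move=> _ [m _ <-]].
Qed.

End Stabilization.

Definition jstab (R : realType) (x : c00 R) : nat := ex_minn (stable_from_ex x).

Definition jset (R : realType) (n : nat) : set nat :=
  [set jstab x | x in [set x : c00 R |
     x 0%N = 0 /\ forall i, (n < i)%N -> x i = 0]].

Definition is_maximum (A : set nat) (J : nat) : Prop := A J /\ ubound A J.

(* Main.v *)
(* Let j = jstab.  If j(x) = m + 1, then x has an optimal admissible family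
   (E_i), and some block E of it satisfies j(E x) = m.

   Upper bound: if moreover m > 0, then the family has exactly as many members
   as its least element, since otherwise E could be cut in two with a strict
   gain.  Hence passing from x to E x deletes at least min (supp x) - 1
   coordinates.  The minimum of the support increases at least
   once in every two steps: if the first block is chosen twice in a row, with
   remaining blocks R_0 and then R_1, the joint family R_1, R_0 is already
   admissible, and it would beat the optimal one.  Summing,
   |supp x| is at least about j(x)^2 / 4.

   Lower bound: from y supported in (l, p), with T-norm V, form x by adding the
   value 2 V at l and the value 4 V at the l - 2 points p, ..., p + l - 3.  Then
   ||x||_(k+1) = (2 V + ||y||_k + 4 V (l - 2)) / 2 for every k, so that
   j(x) > j(y).  Iterating h times costs about h^2 / 2 coordinates. *)
Require Import Defs.
From mathcomp Require Import all_boot all_order all_algebra finmap.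
From mathcomp Require Import boolp classical_sets reals.
From mathcomp Require Import zify ring lra.

Set Implicit Arguments.
Unset Strict Implicit.
Unset Printing Implicit Defensive.

Import Order.TTheory GRing.Theory Num.Theory.
Local Open Scope fset_scope.
Local Open Scope ring_scope.

(** * Norms and admissible families *)

Lemma fmax_in (E : {fset nat}) : E != fset0 -> fmax E \in E.
Proof.
have h (r : seq nat) : r != [::] -> (\max_(i <- r) i)%N \in r.
  elim: r => // a [|b r] IH _; first by rewrite big_seq1 inE.
  rewrite big_cons /maxn; case: ifP => _; last by rewrite inE eqxx.
  by rewrite inE IH ?orbT.
by move=> E0; apply: h; apply: contra_neq E0 => Enil; apply/fsetP => i; rewrite -[i \in E]/(i \in (E : seq nat)) Enil !inE.
Qed.

Lemma fmin_in (E : {fset nat}) : E != fset0 -> fmin E \in E.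
Proof.
have h d (r : seq nat) : \big[minn/d]_(i <- r) i \in d :: r.
  elim: r => [|a r IH]; first by rewrite big_nil inE.
  rewrite big_cons /minn; case: ifP => _; first by rewrite !inE eqxx orbT.
  by move: IH; rewrite !inE => /orP[->//|->]; rewrite !orbT.
move=> E0; have := h (fmax E) E; rewrite inE => /orP[/eqP|//].
by rewrite -/(fmin E) => ->; exact: fmax_in.
Qed.

Lemma fset_lt_mem (E F : {fset nat}) i j :
  fset_lt E F -> i \in E -> j \in F -> (i < j)%N.
Proof.
move=> EF iE jF; apply: (leq_ltn_trans (fmax_ge iE)).
exact: leq_trans EF (fmin_le jF).
Qed.

Lemma fset_ltI (E F : {fset nat}) : E != fset0 -> F != fset0 ->
  (forall i j, i \in E -> j \in F -> (i < j)%N) -> fset_lt E F.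
Proof. by move=> E0 F0; apply; [exact: fmax_in|exact: fmin_in]. Qed.

Lemma fset_lt_sub (A B E F : {fset nat}) : A != fset0 -> B != fset0 ->
  A `<=` E -> B `<=` F -> fset_lt E F -> fset_lt A B.
Proof.
move=> A0 B0 /fsubsetP AE /fsubsetP BF EF; apply: fset_ltI => // i j iA jB.
by apply: (fset_lt_mem EF); [exact: AE|exact: BF].
Qed.

Definition block (E : {fset nat}) := (E != fset0) && (0%N \notin E).

Lemma pairwise_fset_lt_uniq s : all block s -> pairwise fset_lt s -> uniq s.
Proof.
elim: s => //= E s IH /andP[/andP[E0 _] bs] /andP[Es ps].
rewrite IH // andbT; apply/negP => /(allP Es)/fset_lt_mem h.
by have := h _ _ (fmin_in E0) (fmin_in E0); rewrite ltnn.
Qed.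

Lemma card_fmin s : all block s -> pairwise fset_lt s ->
  #|` [fset fmin E | E in s] | = size s.
Proof.
elim: s => [_ _|E s IH /= /andP[/andP[E0 _] bs] /andP[/allP Es ps]].
  by apply/eqP; rewrite cardfs_eq0; apply/eqP/fsetP => i; rewrite inE;
     apply/negP => /imfsetP[].
have -> : [fset fmin A | A in E :: s] = fmin E |` [fset fmin A | A in s].
  apply/fsetP => i; rewrite !inE; apply/imfsetP/predU1P => /=.
    move=> [A]; rewrite inE => /predU1P[->|As] ->; first by left.
    by right; apply/imfsetP; exists A.
  case=> [->|/imfsetP[/= A As ->]]; first by exists E; rewrite ?inE ?eqxx.
  by exists A; rewrite ?inE ?As ?orbT.
rewrite cardfsU1 IH // (_ : _ \notin _) //; apply/negP => /imfsetP[/= A As e].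
have /andP[A0 _] := allP bs _ As.
have := fset_lt_mem (Es _ As) (fmin_in E0) (fmin_in A0).
by rewrite e ltnn.
Qed.

(** Blocks in increasing order have distinct minima, [size s] in number, so the Schreier condition
    says that no element of a member lies below [size s]. *)
Lemma admissibleP s : admissible s <->
  [/\ s != [::], all block s, pairwise fset_lt s &
    forall E i, E \in s -> i \in E -> (size s <= i)%N].
Proof.
split=> [/and4P[s0 bs ss sch]|[s0 bs ps h]].
  have ps := Defs.sorted_pairwise bs ss; split=> // E i Es iE.
  rewrite -(card_fmin bs ps) (leq_trans sch) // (leq_trans _ (fmin_le iE)) //.
  by apply: fmin_le; apply/imfsetP; exists E.
apply/and4P; split=> //; first exact: pairwise_sorted.
rewrite /schreier card_fmin //.
case: s s0 bs ps h => // E s _ bs _ h.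
have /fmin_in/imfsetP[/= A As ->] : [fset fmin E | E in E :: s] != fset0.
  by apply/fset0Pn; exists (fmin E); apply/imfsetP; exists E; rewrite ?inE ?eqxx.
by apply: (h A) => //; apply: fmin_in; case/andP: (allP bs _ As).
Qed.

(** * Domination, stabilization and attainment of the norms *)

Section Norm.
Variable R : realType.
Implicit Types (x y z b : c00 R) (E F : {fset nat}) (s : seq {fset nat}).

Lemma restr_restr E F x : restr E (restr F x) = restr (E `&` F) x.
Proof. by apply/fsfunP => i; rewrite !restrE inE; case: (i \in E). Qed.

Lemma restr_sub E F x : E `<=` F -> restr E (restr F x) = restr E x.
Proof. by move=> EF; rewrite restr_restr (fsetIidPl EF). Qed.

Lemma finsupp_restr E x : finsupp (restr E x) = finsupp x `&` E.
Proof.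
apply/fsetP => i; rewrite inE !mem_finsupp restrE.
by case: ifP; rewrite ?andbT ?andbF // eqxx.
Qed.

(** Over the disjoint members of a family the l_1 masses of [b] add up to at most [l1 b N], so the
    error term survives each level. A zero [b] gives monotonicity; a nonzero one measures added
    coordinates. *)
Lemma tnorm_le_sum k x y b N :
  (forall i, (N <= i)%N -> b i = 0) ->
  (forall i, (0 < i)%N -> `|x i| <= `|y i| + `|b i|) ->
  tnorm k x <= tnorm k y + l1 b N.
Proof.
elim: k x y b => [|k IH] x y b bN xyb /=.
  apply: ge_sup; first by exists `|x 1%N|, 1%N.
  move=> _ [i i0 <-]; apply: (le_trans (xyb _ i0)); apply: lerD.
    have [M yM] := c00_bound y.
    apply: ub_le_sup; last by exists i.
    by exists (l1 y M) => _ [j _ <-]; exact: norm_le_l1.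
  exact: norm_le_l1.
have l0 c : 0 <= l1 c N by apply: sumr_ge0.
apply: tnormS_le => [|s sA].
  apply: (le_trans (IH _ _ _ bN xyb)); rewrite lerD2r.
  exact: (le_tnorm y (leqnSn k)).
apply: (@le_trans _ _ (2^-1 * \sum_(E <- s)
    (tnorm k (restr E y) + l1 (restr E b) N))).
  rewrite ler_pM2l ?invr_gt0 ?ltr0n //; apply: ler_sum => E _; apply: IH.
    exact: restr_out.
  by move=> i i0; rewrite !restrE; case: ifP => // _; [exact: xyb|rewrite normr0 addr0].
rewrite big_split mulrDr lerD //; first exact: le_tnormS.
have := sum_l1 b N sA.
have : 0 <= \sum_(E <- s) l1 (restr E b) N by apply: sumr_ge0 => E _; exact: l0.
by move=> /= h1 h2; lra.
Qed.

Lemma tnorm_mono k x y : (forall i, (0 < i)%N -> `|x i| <= `|y i|) ->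
  tnorm k x <= tnorm k y.
Proof.
move=> xy; have := @tnorm_le_sum k x y [fsfun] 0.
rewrite /l1 big_ord0 addr0; apply; first by move=> i _; rewrite fsfun0E.
move=> i i0; rewrite fsfun0E.
by rewrite normr0 addr0; exact: xy.
Qed.

Lemma tnorm_restr k E x : tnorm k (restr E x) <= tnorm k x.
Proof.
by apply: tnorm_mono => i _; rewrite restrE; case: ifP; rewrite // normr0.
Qed.

Lemma norm_le_tnorm k x i : (0 < i)%N -> `|x i| <= tnorm k x.
Proof.
move=> i0; apply: le_trans (le_tnorm x (leq0n k)).
have [M xM] := c00_bound x; apply: ub_le_sup; last by exists i.
by exists (l1 x M) => _ [j _ <-]; exact: norm_le_l1.
Qed.

Lemma tnorm0_le x c : (forall i, (0 < i)%N -> `|x i| <= c) -> tnorm 0 x <= c.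
Proof.
move=> xc; apply: ge_sup; first by exists `|x 1%N|, 1%N.
by move=> _ [i i0 <-]; exact: xc.
Qed.

Lemma jstabP x k : (jstab x <= k)%N -> tnorm k x = tsirelson x.
Proof. by rewrite /jstab; case: ex_minnP => M /asboolP + _; apply. Qed.

Lemma tnorm_le_tsirelson k x : tnorm k x <= tsirelson x.
Proof.
rewrite -(@jstabP x (jstab x + k)) ?leq_addr //; apply: le_tnorm.
exact: leq_addl.
Qed.

(** The norms increase with the level and never exceed [tsirelson x], so one level that reaches the
    limit settles all later ones. *)
Lemma jstab_le x k : (jstab x <= k)%N = (tnorm k x == tsirelson x).
Proof.
apply/idP/eqP => [/jstabP//|xk]; rewrite /jstab; case: ex_minnP => M _; apply.
apply/asboolP => l kl; apply/eqP; rewrite eq_le tnorm_le_tsirelson /= -xk.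
exact: le_tnorm.
Qed.

Lemma jstab_gt x k : (k < jstab x)%N = (tnorm k x < tsirelson x).
Proof. by rewrite ltnNge jstab_le lt_neqAle tnorm_le_tsirelson andbT. Qed.

Lemma sum_le_tsirelson x s : admissible s ->
  2^-1 * \sum_(E <- s) tsirelson (restr E x) <= tsirelson x.
Proof.
move=> sA; pose k := (\max_(E <- s) jstab (restr E x))%N.
rewrite (le_trans _ (tnorm_le_tsirelson k.+1 x)) //.
apply: le_trans (le_tnormS k x sA).
rewrite ler_pM2l ?invr_gt0 ?ltr0n // big_seq [leRHS]big_seq.
apply: ler_sum => E Es; rewrite jstabP //.
exact: (@leq_bigmax_seq _ _ xpredT (fun E => jstab (restr E x))).
Qed.

Lemma tsirelson_ge0 x : 0 <= tsirelson x.
Proof. by rewrite -(jstabP (leqnn _)) tnorm_ge0. Qed.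

Lemma tsirelson_gt0 x i : (0 < i)%N -> x i != 0 -> 0 < tsirelson x.
Proof.
move=> i0 xi; apply: lt_le_trans (tnorm_le_tsirelson 0 x).
by apply: lt_le_trans (norm_le_tnorm 0 x i0); rewrite normr_gt0.
Qed.

(** Members can be cut down to the support, which leaves finitely many families, so the supremum is
    a maximum; strictness excludes that the value comes from level [k]. *)
Lemma tnormS_attained k x : tnorm k x < tnorm k.+1 x ->
  exists s, [/\ admissible s, forall E, E \in s -> E `<=` finsupp x &
    tnorm k.+1 x = 2^-1 * \sum_(E <- s) tnorm k (restr E x)].
Proof.
pose val (F : {fset {fset nat}}) := 2^-1 * \sum_(E <- F) tnorm k (restr E x).
pose good s := admissible s /\ forall E, E \in s -> E `<=` finsupp x.
pose P (F : {fset {fset nat}}) := `[< exists2 s, good s & val F = 2^-1 * \sum_(E <- s) tnorm k (restr E x) >].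
(* Families are encoded as finite sets of subsets of the support, which makes this a finite maximum
   with default [tnorm k x]. *)
set c := \big[Num.max/tnorm k x]_(F <- fpowerset (fpowerset (finsupp x)) | P F) val F.
move=> lt_k.
have le_kc : tnorm k x <= c.
  by rewrite /c; elim/big_rec: _ => // F d _ h; rewrite le_max h orbT.
have le_c : tnorm k.+1 x <= c.
  apply: tnormS_le => // s /admissibleP[s0 bs ps hs].
  (* Shrinking members and dropping empty ones keeps the order and cannot increase the number of
     members. *)
  pose s' := [seq E <- [seq finsupp x `&` E | E <- s] | E != fset0].
  have -> : \sum_(E <- s) tnorm k (restr E x) = \sum_(E <- s') tnorm k (restr E x).
    rewrite big_filter big_map [LHS](bigID (fun E => finsupp x `&` E == fset0)) /=.
    rewrite big1 ?add0r => [|E /eqP E0].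
      by apply: eq_bigr => E _; rewrite restrI.
    rewrite -restrI E0; apply: tnorm0 => i; by rewrite restrE inE.
  have [->|s'0] := eqVneq s' [::].
    by rewrite big_nil mulr0 (le_trans (tnorm_ge0 k x)).
  have mem' E : E \in s' -> exists2 A, A \in s & E = finsupp x `&` A /\ E != fset0.
    by rewrite mem_filter => /andP[E0 /mapP[A As eE]]; exists A.
  have bs' : all block s'.
    apply/allP => E /mem'[A /(allP bs)/andP[_ A0] [-> E0]].
    by rewrite /block E0 inE (negbTE A0) andbF.
  have ps' : pairwise fset_lt s'.
    rewrite /s' {s'0 mem' bs'}; elim: s {s0 bs hs s'} ps => //= A s IH /andP[/allP As ps].
    case: ifP => A0; last exact: IH.
    rewrite /= IH // andbT; apply/allP => E.
    rewrite mem_filter => /andP[E0 /mapP[B Bs eE]]; rewrite eE in E0 *.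
    by apply: fset_lt_sub (As _ Bs); rewrite ?A0 ?fsubsetIr.
  have gs' : good s'.
    split; last by move=> E /mem'[A _ [-> _]]; exact: fsubsetIl.
    apply/admissibleP; split=> // E i /mem'[A As [-> _]].
    rewrite inE => /andP[_ iA]; apply: leq_trans (hs _ _ As iA).
    by rewrite size_filter (leq_trans (count_size _ _)) // size_map.
  pose F := [fset E | E in s'].
  have vF : val F = 2^-1 * \sum_(E <- s') tnorm k (restr E x).
    congr (_ * _); apply: perm_big; apply: uniq_perm.
    - exact: fset_uniq.
    - exact: pairwise_fset_lt_uniq.
    - by move=> E; apply/imfsetP/idP => [[A /= As ->]//|Es]; exists E.
  have PF : P F by apply/asboolP; exists s'.
  have Fx : F \in fpowerset (fpowerset (finsupp x)).
    rewrite fpowersetE; apply/fsubsetP => E /imfsetP[/= A As ->].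
    by rewrite fpowersetE; exact: gs'.2.
  rewrite -vF /c; move: Fx; rewrite -[F \in _]/(F \in (fpowerset _ : seq _)).
  elim: (fpowerset _ : seq _) => // G r IH; rewrite inE big_cons.
  by move=> /predU1P[<-|/IH h]; rewrite ?PF ?le_max ?lexx //; case: ifP; rewrite ?le_max ?h ?orbT.
have : c = tnorm k x \/ exists2 s, good s & c = 2^-1 * \sum_(E <- s) tnorm k (restr E x).
  rewrite /c; elim/big_rec: _ => [|F d /asboolP[s gs vs] h]; first by left.
  by rewrite /Num.max; case: ifP => _; [exact: h|right; exists s].
case=> [cE|[s [sA sx] cE]]; first by rewrite cE leNgt lt_k in le_c.
exists s; split=> //; apply/eqP; rewrite eq_le le_tnormS // -cE le_c //.
Qed.

End Norm.

(** * Upper bound *)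

Section Upper.
Variable R : realType.
Implicit Types (x y z : c00 R) (E F G : {fset nat}) (s : seq {fset nat}).

Definition attains s x :=
  [/\ admissible s, forall F, F \in s -> F `<=` finsupp x &
    tsirelson x = 2^-1 * \sum_(F <- s) tsirelson (restr F x)].

Lemma tsirelson_restr_gt0 s x F : attains s x -> F \in s ->
  0 < tsirelson (restr F x).
Proof.
case=> /admissibleP[_ bs _ _] sx _ Fs; have /andP[F0 F00] := allP bs _ Fs.
have iF := fmin_in F0; apply: (@tsirelson_gt0 _ _ (fmin F)).
  by case: (fmin F) iF F00 => [->|].
by rewrite restrE iF -mem_finsupp (fsubsetP (sx _ Fs)).
Qed.

(** With [k] the index of the restriction, its limit norm is at most [tnorm k x], and [x] has not
    stabilized at level [k]. *)
Lemma tsirelson_restr_lt E x : (jstab (restr E x) < jstab x)%N ->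
  tsirelson (restr E x) < tsirelson x.
Proof.
rewrite jstab_gt; apply: le_lt_trans; rewrite -(jstabP (leqnn _)).
exact: tnorm_restr.
Qed.

(** A family that reaches the limit norm at level m + 1 forces each member to have stabilized by
    level [m]. If all had done so earlier, level [m] would already give the limit norm of [x]. *)
Lemma jstab_attains x m : jstab x = m.+1 ->
  exists s1 E s2, attains (s1 ++ E :: s2) x /\ jstab (restr E x) = m.
Proof.
move=> xm; have Tm : tnorm m.+1 x = tsirelson x by apply: jstabP; rewrite xm.
have ltm : tnorm m x < tsirelson x by rewrite -jstab_gt xm.
have [s [sA sx e]] : exists s, [/\ admissible s,
    forall E, E \in s -> E `<=` finsupp x &
    tnorm m.+1 x = 2^-1 * \sum_(E <- s) tnorm m (restr E x)].
  by apply: tnormS_attained; rewrite Tm.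
have le_s E : E \in s -> tnorm m (restr E x) <= tsirelson (restr E x).
  by move=> _; exact: tnorm_le_tsirelson.
have eqs E : E \in s -> tnorm m (restr E x) = tsirelson (restr E x).
  move=> Es; apply/eqP; rewrite eq_le le_s //=.
  have : \sum_(F <- s) tsirelson (restr F x) <= \sum_(F <- s) tnorm m (restr F x).
    by have := sum_le_tsirelson x sA; rewrite -Tm e ler_pM2l // invr_gt0 ltr0n.
  rewrite !(big_rem E Es) /= => h.
  have : \sum_(F <- rem E s) tnorm m (restr F x) <=
         \sum_(F <- rem E s) tsirelson (restr F x).
    by apply: ler_sum => F _; exact: tnorm_le_tsirelson.
  by lra.
have aT : attains s x.
  split=> //; rewrite -Tm e; congr (_ * _); rewrite big_seq [RHS]big_seq.
  exact: eq_bigr.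
have [/hasP[E Es /eqP Em]|/hasPn no] :=
    boolP (has (fun E => jstab (restr E x) == m) s).
  by case/splitPr: Es aT => s1 s2 aT; exists s1, E, s2.
have ltj E : E \in s -> (jstab (restr E x) < m)%N.
  by move=> Es; rewrite ltn_neqAle no //= jstab_le eqs.
case: m {xm Tm e le_s eqs no} ltm ltj => [_|m ltm] ltj.
  by case/admissibleP: sA; case: s {sx aT} ltj => // E s /(_ E); rewrite inE eqxx => /(_ isT).
have [_ _ Tx] := aT; have := le_tnormS m x sA.
rewrite (_ : \sum_(E <- s) _ = \sum_(E <- s) tsirelson (restr E x)).
  by rewrite -Tx leNgt ltm.
by rewrite big_seq [RHS]big_seq; apply: eq_bigr => E Es; rewrite jstabP // -ltnS ltj.
Qed.

(* A non-singleton child could otherwise be cut after its first block without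
   leaving the Schreier family, and cutting doubles the weight of that block. *)
Lemma attains_full s1 E s2 x : attains (s1 ++ E :: s2) x ->
  (0 < jstab (restr E x))%N ->
  exists2 F, F \in s1 ++ E :: s2 & size (s1 ++ E :: s2) \in F.
Proof.
set s := s1 ++ E :: s2; set y := restr E x => sT.
have [sA sx Tx] := sT; have /admissibleP[_ bs ps hs] := sA.
case yj : (jstab y) => [//|m] _.
have [s1' [E' [s2' [s'T jE']]]] := jstab_attains yj.
have ltE' : tsirelson (restr E' y) < tsirelson y.
  by apply: tsirelson_restr_lt; rewrite jE' yj.
move: s'T; case def_s': (s1' ++ E' :: s2') => [|F s'] s'T; first by case: s1' def_s'.
have [s'A s'y Ty] := s'T; have /admissibleP[_ bs' ps' hs'] := s'A.
have Es : E \in s by rewrite mem_cat inE eqxx orbT.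
have subE A : A \in F :: s' -> A `<=` E.
  by move/s'y; rewrite finsupp_restr => h; apply: fsubset_trans h (fsubsetIr _ _).
(* A one-member family would make the norm of [y] half that of a restriction of [y], which is
   impossible; so [s'] is not empty. *)
case s'nil : s' => [|A0 s0'].
  have /eqP FE : E' == F.
    have : E' \in [:: F] by rewrite -s'nil -def_s' mem_cat inE eqxx orbT.
    by rewrite inE.
  have := tsirelson_restr_gt0 s'T (mem_head _ _).
  by move: Ty ltE'; rewrite s'nil big_seq1 FE => h1 h2 h3; lra.
have s'0 : s' != [::] by rewrite s'nil.
have A0s' : A0 \in s' by rewrite s'nil mem_head.
move: {s'nil} bs' ps' => /= /andP[bF bs'] /andP[/allP Fs' ps'].
pose G := [fset i in E | (fmax F < i)%N].
have GE : G `<=` E by apply/fsubsetP => i; rewrite !inE => /andP[].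
have subG A : A \in s' -> A `<=` G.
  move=> As; apply/fsubsetP => i iA; rewrite !inE.
  rewrite (fsubsetP (subE A _) i iA) ?inE ?As ?orbT //=.
  by apply: leq_trans (Fs' _ As) (fmin_le iA).
have bG : block G.
  apply/andP; split; last by rewrite !inE ltn0 andbF.
  have /andP[/fset0Pn[i iA] _] := allP bs' _ A0s'.
  by apply/fset0Pn; exists i; exact: (fsubsetP (subG _ A0s')).
have FE : F `<=` E by apply: subE; rewrite inE eqxx.
have [/andP[F0 _] /andP[G0 _]] := (bF, bG).
have FG : fset_lt F G.
  by apply: fset_ltI => // i j iF; rewrite !inE => /andP[_]; apply: leq_ltn_trans (fmax_ge iF).
have [/hasP[B Bs nB]|/hasPn no] := boolP (has (fun B : {fset nat} => size s \in B) s).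
  by exists B.
have nos B i : B \in s -> i \in B -> (size s < i)%N.
  move=> Bs iB; rewrite ltn_neqAle (hs _ _ Bs iB) andbT.
  by apply: contra (no _ Bs) => /eqP ->.
(* All elements now exceed [size s], so one more member is allowed: [E] is split into [F] and the
   rest [G] beyond it, which contains the members of [s']. *)
pose t := s1 ++ F :: G :: s2.
have st : size t = (size s).+1 by rewrite !size_cat /= !addnS.
have inS B : B \in s1 ++ s2 -> B \in s.
  by rewrite !mem_cat inE => /orP[->|->]; rewrite ?orbT.
have tA : admissible t.
  apply/admissibleP; split; first by rewrite -size_eq0 st.
  - move: bs; rewrite !all_cat /= bF bG /= => /and3P[-> _ ->] //.
  - move: ps; rewrite !pairwise_cat !pairwise_cons !allrel_consr.
    move=> /and3P[/andP[/allP aE a12] p1 /andP[/allP aE' p2]].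
    have /allP b1 : all block s1 by move: bs; rewrite all_cat => /andP[].
    have /allP b2 : all block s2 by move: bs; rewrite all_cat /= => /and3P[].
    rewrite a12 p1 p2 /= FG !andbT /= -!andbA; apply/and4P; split; apply/allP => B Bs.
    + by have /andP[? _] := b1 _ Bs; apply: fset_lt_sub (aE _ Bs).
    + by have /andP[? _] := b1 _ Bs; apply: fset_lt_sub (aE _ Bs).
    + by have /andP[? _] := b2 _ Bs; apply: fset_lt_sub (aE' _ Bs).
    + by have /andP[? _] := b2 _ Bs; apply: fset_lt_sub (aE' _ Bs).
  - move=> B i; rewrite st mem_cat !inE => /or4P[Bs|/eqP->|/eqP->|Bs] iB.
    + by apply: (nos B); rewrite ?inS ?mem_cat ?Bs.
    + by apply: (nos E) => //; exact: (fsubsetP FE).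
    + by apply: (nos E) => //; exact: (fsubsetP GE).
    + by apply: (nos B); rewrite ?inS ?mem_cat ?Bs ?orbT.
have := sum_le_tsirelson x tA; rewrite Tx !big_cat /= !big_cons -/y.
have s'A' : admissible s'.
  apply/admissibleP; split=> // A i As iA.
  by apply: leq_trans (hs' A i _ iA); rewrite ?inE ?As ?orbT.
have := sum_le_tsirelson (restr G x) s'A'.
rewrite (_ : \sum_(A <- s') _ = \sum_(A <- s') tsirelson (restr A y)); last first.
  rewrite big_seq [RHS]big_seq; apply: eq_bigr => A As.
  by rewrite !restr_sub ?subG // subE // inE As orbT.
(* [F] now counts fully, and [G] has norm at least half the sum over [s']; together they exceed the
   norm of [y] by at least half that of [F]. *)
have := tsirelson_restr_gt0 s'T (mem_head _ _).
move: Ty; rewrite big_cons (restr_sub _ FE); lra.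
Qed.

(** * Loss of support along optimal families *)

Lemma sum_card_fset s (D : {fset nat}) : admissible s ->
  (forall F, F \in s -> F `<=` D) -> (\sum_(F <- s) #|` F| <= #|` D|)%N.
Proof.
move=> sA sD.
have cF F : F \in s -> #|` F| = (\sum_(i <- D) (i \in F))%N.
  move=> Fs; rewrite -big_mkcond sum1_count -size_filter; apply: perm_size.
  apply: uniq_perm; rewrite ?filter_uniq ?fset_uniq // => i.
  by rewrite mem_filter; apply/idP/andP => [iF|[]//]; rewrite iF (fsubsetP (sD _ Fs)).
rewrite big_seq (eq_bigr _ cF) -big_seq exchange_big /=.
apply: (@leq_trans (\sum_(i <- D) 1)); last by rewrite sum1_size.
by apply: leq_sum => i _; exact: admissible_count.
Qed.

(** Each member other than [E] is disjoint from it and takes at least one coordinate. *)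
Lemma card_step s1 E s2 x : attains (s1 ++ E :: s2) x ->
  (#|` E| + size (s1 ++ E :: s2) <= #|` finsupp x|.+1)%N.
Proof.
case=> sA sx _; have := sum_card_fset sA sx; have /admissibleP[_ bs _ _] := sA.
have c s : all block s -> (size s <= \sum_(F <- s) #|` F|)%N.
  move=> /allP b; rewrite -sum1_size big_seq [leqRHS]big_seq.
  by apply: leq_sum => F /b/andP[]; rewrite cardfs_gt0.
move: bs; rewrite all_cat /= => /and3P[/c c1 _ /c c2].
rewrite big_cat big_cons size_cat /= !addnS ltnS; apply: leq_trans.
by rewrite addnCA leq_add ?leq_add2l.
Qed.

(** The child has positive index, so [attains_full] applies; the family size is then a point of the
    support, hence at least its minimum. With [card_step] this bounds the loss from below. *)
Lemma jstab_step x m : jstab x = m.+2 ->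
  exists s1 E s2, [/\ attains (s1 ++ E :: s2) x, jstab (restr E x) = m.+1,
    finsupp (restr E x) = E & size (s1 ++ E :: s2) \in finsupp x].
Proof.
move=> /jstab_attains[s1 [E [s2 [sT jE]]]]; exists s1, E, s2.
have [_ sx _] := sT; have Es : E \in s1 ++ E :: s2 by rewrite mem_cat mem_head orbT.
split=> //; first by rewrite finsupp_restr; apply/fsetIidPr; exact: sx.
have [|F Fs iF] := attains_full sT; first by rewrite jE.
by exact: (fsubsetP (sx _ Fs)).
Qed.

Lemma card_le_fmax E a : E != fset0 -> (forall i, i \in E -> (a <= i)%N) ->
  (#|` E| + a <= (fmax E).+1)%N.
Proof.
move=> E0 aE; have aM := aE _ (fmax_in E0).
suff : (#|` E| <= size (iota a ((fmax E).+1 - a)))%N.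
  by rewrite size_iota; lia.
apply: uniq_leq_size; first exact: fset_uniq.
by move=> i iE; rewrite mem_iota aE //= subnKC ?ltnS ?fmax_ge // leqW.
Qed.

(** Each of two descents loses at least l - 1 coordinates. The index [m.+4] leaves room for a third
    descent, from [z], used only to bound the size of the joint family. *)
Lemma jstab_two_step x m l : jstab x = m.+4 ->
  (forall i, i \in finsupp x -> (l <= i)%N) ->
  exists z, [/\ jstab z = m.+2, forall i, i \in finsupp z -> (l < i)%N &
    (#|` finsupp z| + l.-1.*2 <= #|` finsupp x|)%N].
Proof.
move=> /jstab_step[s1 [E [s2 [sT jE fE nx]]]] lx; set y := restr E x in jE fE.
have [s1' [E' [s2' [s'T jE' fE' ny]]]] := jstab_step jE.
set z := restr E' y in jE' fE'.
have [sA sx Tx] := sT; have [s'A s'y Ty] := s'T.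
have E'E : E' `<=` E by rewrite -fE; apply: s'y; rewrite mem_cat mem_head orbT.
have Ex : E `<=` finsupp x by apply: sx; rewrite mem_cat mem_head orbT.
have c1 := card_step sT; have c2 := card_step s'T; rewrite fE in c2.
have l1 := lx _ nx; have l2 : (l <= size (s1' ++ E' :: s2'))%N.
  by apply: lx; rewrite (fsubsetP Ex) // -fE.
have fin : (forall i, i \in E' -> (l < i)%N) -> exists z, [/\ jstab z = m.+2,
    forall i, i \in finsupp z -> (l < i)%N &
    (#|` finsupp z| + l.-1.*2 <= #|` finsupp x|)%N].
  move=> h; exists z; split=> //; rewrite fE' //.
  by move: c1 c2 l1 l2; rewrite !size_cat /= !addnS; lia.
have [_ bs ps hs] := (admissibleP _).1 sA.
have [_ bs' ps' hs'] := (admissibleP _).1 s'A.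
(* A member to the left of [E] or [E'] supplies a point of the support below all of [E']. *)
have before A i : A \in s1 \/ A \in s1' -> i \in E' -> (l < i)%N.
  move=> AsAs' iE'; have [a [aA ax ltai]] : exists a, [/\ a \in A, a \in finsupp x & (a < i)%N].
    case: AsAs' => As.
      have /andP[/fset0Pn[a aA] _] : block A by rewrite (allP bs) // mem_cat As.
      exists a; split=> //; first by apply: (fsubsetP (sx A _)) => //; rewrite mem_cat As.
      move: ps; rewrite pairwise_cat allrel_consr => /andP[/andP[/allP h _] _].
      exact: fset_lt_mem (h _ As) aA (fsubsetP E'E _ iE').
    have /andP[/fset0Pn[a aA] _] : block A by rewrite (allP bs') // mem_cat As.
    have aE : a \in E by rewrite -fE; apply: (fsubsetP (s'y A _)) => //; rewrite mem_cat As.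
    exists a; split=> //; first exact: (fsubsetP Ex).
    move: ps'; rewrite pairwise_cat allrel_consr => /andP[/andP[/allP h _] _].
    exact: fset_lt_mem (h _ As) aA iE'.
  exact: leq_ltn_trans (lx _ ax) ltai.
have [|] := eqVneq (s1 ++ s1') [::]; last first.
  case s11 : (s1 ++ s1') => [//|A r] _; apply: fin => i; apply: (before A).
  by apply/orP; rewrite -mem_cat s11 mem_head.
move=> /eqP; rewrite -size_eq0 size_cat addn_eq0 !size_eq0 => /andP[/eqP s10 /eqP s1'0].
exfalso; subst s1 s1'; rewrite /= in bs ps hs bs' ps' hs' Tx Ty c1 c2.
(* Both chosen blocks come first. A third optimal family, inside [E'] and of size [p], shows that
   [E'] has at least [p] elements and contains [p]. *)
have [s1'' [E'' [s2'' [s''T _ _ nz]]]] := jstab_step jE'.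
have c3 := card_step s''T; rewrite fE' in c3 nz.
have E''0 : (0 < #|` E''|)%N.
  have [/admissibleP[_ /allP h _ _] _ _] := s''T.
  have /h/andP[] : E'' \in s1'' ++ E'' :: s2'' by rewrite mem_cat mem_head orbT.
  by rewrite cardfs_gt0.
set p := size (s1'' ++ _) in c3 nz.
have AE' i : i \in E' -> ((size s2).+1 <= i)%N.
  by move=> iE'; apply: (hs E); rewrite ?mem_head // (fsubsetP E'E).
have BE' i : i \in E' -> ((size s2').+1 <= i)%N by apply: hs'; rewrite mem_head.
have E'0 : E' != fset0 by apply/fset0Pn; exists p.
have cE' := card_le_fmax E'0 AE'.
(* [E'] has more than [size s2'] elements, all above [size s2], so its maximum reaches the size of
   the joint family. *)
have dE' : (size s2 + size s2' <= fmax E')%N.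
  by have := BE' _ nz; move: c3 cE' E''0; clear; lia.
move: ps ps' => /andP[/allP Es2 ps2] /andP[/allP Es2' ps2'].
move: bs bs' => /andP[_ bs2] /andP[_ bs2'].
have lty : tsirelson z < tsirelson y by apply: tsirelson_restr_lt; rewrite jE jE'.
rewrite !big_cons -/y -/z in Tx Ty.
have s2'0 : s2' != [::].
  apply/eqP => s2'0; have := tsirelson_ge0 y.
  by move: Ty; rewrite s2'0 big_nil; move: lty; lra.
have sub' F : F \in s2' -> F `<=` E.
  by move=> Fs; rewrite -fE; apply: s'y; rewrite inE Fs orbT.
have tA : admissible (s2' ++ s2).
  apply/admissibleP; split; first by case: (s2') s2'0.
  - by rewrite all_cat bs2 bs2'.
  - rewrite pairwise_cat ps2 ps2' !andbT; apply/allrelP => A B As Bs.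
    have /andP[A0 _] := allP bs2' _ As; have /andP[B0 _] := allP bs2 _ Bs.
    by apply: fset_lt_sub (Es2 _ Bs) => //; exact: sub'.
  - move=> A i; rewrite mem_cat size_cat addnC => /orP[] As iA; apply: (leq_trans dE').
      exact: ltnW (fset_lt_mem (Es2' _ As) (fmax_in E'0) iA).
    exact: ltnW (fset_lt_mem (Es2 _ As) (fsubsetP E'E _ (fmax_in E'0)) iA).
have := sum_le_tsirelson x tA; rewrite big_cat /=.
rewrite (_ : \sum_(A <- s2') tsirelson (restr A x) =
             \sum_(A <- s2') tsirelson (restr A y)); last first.
  by rewrite big_seq [RHS]big_seq; apply: eq_bigr => A As; rewrite restr_sub ?sub'.
(* The sum over [s2'] is twice the norm of [y] minus that of [z], which exceeds the norm of [y]; so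
   [s2'] in place of [E] would beat the optimum. *)
by move: Tx Ty lty; lra.
Qed.

(** Double step number i, counted from 0, starts with support beyond l + i and deletes at least 2(l
    + i) points. Summing over i < t gives the left side; a nonzero vector remains, whence
    strictness. *)
Lemma jstab_support t x l : (t.*2.+1 < jstab x)%N ->
  (forall i, i \in finsupp x -> (l < i)%N) ->
  (t.*2 * l + t * t.-1 < #|` finsupp x|)%N.
Proof.
elim: t x l => [|t IH] x l tx lx.
  rewrite cardfs_gt0; apply: contraTneq (ltnW tx) => x0.
  have xi i : x i = 0 by apply: fsfun_dflt; rewrite x0 inE.
  by rewrite jstab_gt -(jstabP (leqnn _)) !tnorm0 // ltxx.
case jx : (jstab x) tx => [//|[//|[//|[//|m]]]] tx.
have [z [jz lz cz]] := jstab_two_step jx lx.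
have := IH z l.+1 _ lz; rewrite jz => /(_ tx); move: cz => /=.
clear; case: t => [|t] /=; nia.
Qed.

Lemma jstab_sqr_le x n : x 0%N = 0 -> (forall i, (n < i)%N -> x i = 0) ->
  ((jstab x - 4) ^ 2 <= 4 * n)%N.
Proof.
move=> x0 xn.
have supp i : i \in finsupp x -> (0 < i <= n)%N.
  rewrite mem_finsupp => xi; apply/andP; split.
    by rewrite lt0n; apply: contra_neq xi => ->.
  by rewrite leqNgt; apply: contra xi => /xn ->.
have cn : (#|` finsupp x| <= n)%N.
  rewrite -(size_iota 1 n); apply: uniq_leq_size; first exact: fset_uniq.
  by move=> i /supp; rewrite mem_iota add1n ltnS.
have [j4|j4] := leqP (jstab x) 4; first by rewrite (eqnP j4).
(* The largest [t] that [jstab_support] allows; then j - 4 <= 2t - 1, and (2t - 1)^2 = 4t(t - 1) +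
   1. *)
pose t := (jstab x - 2)./2.
have tj : (t.*2.+1 < jstab x)%N by rewrite /t; lia.
have jt : (jstab x <= t.*2 + 3)%N by rewrite /t; lia.
have := @jstab_support t x 0 tj.
rewrite muln0 add0n => /(_ (fun i h => proj1 (andP (supp i h)))) ct.
have tn : (t * t.-1 < n)%N := leq_trans ct cn.
have t0 : (0 < t)%N by lia.
move: jt tn t0 j4; clear; nia.
Qed.
End Upper.

(** * Lower bound *)

Definition singles p m : seq {fset nat} := [seq [fset i] | i <- iota p m].

Lemma singlesP p m E :
  reflect (exists2 i, (p <= i < p + m)%N & E = [fset i]) (E \in singles p m).
Proof.
by apply: (iffP mapP) => -[i ip ->]; exists i; rewrite // mem_iota in ip *.
Qed.

Lemma block1 i : (0 < i)%N -> block [fset i].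
Proof.
move=> i0; apply/andP; split; first by apply/fset0Pn; exists i; rewrite inE.
by rewrite inE eq_sym -lt0n.
Qed.

Lemma block_singles p m : (0 < p)%N -> all block (singles p m).
Proof.
by move=> p0; apply/allP => E /singlesP[i /andP[pi _] ->]; apply/block1/(leq_trans p0).
Qed.

Lemma pairwise_singles p m : pairwise fset_lt (singles p m).
Proof.
have f1 i : [fset i] != fset0 :> {fset nat} by apply/fset0Pn; exists i; rewrite inE.
rewrite pairwise_map; have := iota_ltn_sorted p m.
rewrite sorted_pairwise; last exact: ltn_trans.
apply: sub_pairwise => i j ij /=.
by apply: fset_ltI => // a b; rewrite !inE => /eqP -> /eqP ->.
Qed.

Section Lower.
Variable R : realType.
Implicit Types (x y z : c00 R) (E F G : {fset nat}) (s : seq {fset nat}).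

Lemma sum_singles_ge k x p m c : (0 < p)%N ->
  (forall i, (p <= i < p + m)%N -> c <= `|x i|) ->
  c * m%:R <= \sum_(E <- singles p m) tnorm k (restr E x).
Proof.
move=> p0 xc; rewrite big_map.
have -> : c * m%:R = \sum_(i <- iota p m) c.
  by rewrite big_const_seq count_predT size_iota -Monoid.iteropE /= mulr_natr.
rewrite big_seq [leRHS]big_seq; apply: ler_sum => i; rewrite mem_iota => ip.
apply: le_trans (xc i ip) _; have /andP[pi _] := ip.
apply: le_trans (norm_le_tnorm k _ (leq_trans p0 pi)).
by rewrite restrE inE eqxx.
Qed.

(** Three unit coordinates have sup norm 1, while their singletons, admissible as l >= 3, already
    give 3/2. *)
Lemma jstab_three l : (2 < l)%N ->
  exists y, (forall i, y i != 0 -> (l <= i < l + 3)%N) /\ (0 < jstab y)%N.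
Proof.
move=> l2; pose y : c00 R := [fsfun i in [fset i in iota l 3] => (1 : R) | 0].
have yE i : y i = if (l <= i < l + 3)%N then 1 else 0.
  by rewrite /y fsfunE; congr (if _ then _ else _); rewrite !inE; lia.
exists y; split=> [i|]; first by rewrite yE; case: ifP => //; rewrite eqxx.
rewrite jstab_gt; apply: (@le_lt_trans _ _ 1).
  by apply: tnorm0_le => i _; rewrite yE; case: ifP => _; rewrite ?normr1 ?normr0 ?ler01.
apply: (@lt_le_trans _ _ (2^-1 * (1 * 3%:R))); first lra.
apply: le_trans (tnorm_le_tsirelson 1 y).
have l0 : (0 < l)%N by lia.
have sA : admissible (singles l 3).
  apply/admissibleP; split=> //; [exact: block_singles|exact: pairwise_singles|].
  move=> E i /singlesP[j /andP[lj _] ->]; rewrite inE size_map size_iota => /eqP ->.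
  exact: leq_trans lj.
apply: le_trans (le_tnormS 0 y sA); rewrite ler_pM2l ?invr_gt0 ?ltr0n //.
by apply: sum_singles_ge => // i il; rewrite yE il normr1.
Qed.

(** * A single extension step *)

Section Extend.
Variables (y : c00 R) (l p : nat).
Hypothesis l4 : (4 <= l)%N.
Hypothesis lp : (l.+1 < p)%N.
Hypothesis ylp : forall i, y i != 0 -> (l < i < p)%N.
Let V := tsirelson y.
Let N := (p + (l - 2))%N.

(** The weights make a set that contains [l] but no tail point worth at most 2V, and one with t > 0
    tail points at most 2(t + 1)V. Tail points are thus best used as singletons, and merging two of
    them costs 2V in this estimate. *)
Definition extend : c00 R := [fsfun i in [fset i in iota l (N - l)] =>
  if i == l then 2 * V else if (i < p)%N then y i else 4 * V | 0].
Let x := extend.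

Let outer := restr (l |` [fset i in iota p (l - 2)]) x.
Let tail E := (\sum_(p <= i < N) (i \in E))%N.

Let V0 : 0 <= V. Proof. exact: tsirelson_ge0. Qed.

Lemma extendE i : x i = if i == l then 2 * V else if (i < p)%N then y i
  else if (i < N)%N then 4 * V else 0.
Proof.
rewrite /x /extend fsfunE inE mem_iota; case: eqP => [->|/eqP il].
  by rewrite leqnn subnKC /N; [case: ifP => //|]; lia.
have [ip|pi] := ltnP i p; last by rewrite subnKC /N; [congr (if _ then _ else _)|]; lia.
case: ifP => // h; apply/esym/eqP; apply: contraFT h => /ylp; rewrite /N; lia.
Qed.

Lemma outerE i : outer i =
  if i == l then 2 * V else if (p <= i < N)%N then 4 * V else 0.
Proof.
rewrite restrE !inE mem_iota extendE /N; case: eqP => //= _.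
by case: ifP => // /andP[pi ->]; rewrite ltnNge pi.
Qed.

Lemma outer_out i : (N <= i)%N -> outer i = 0.
Proof. by rewrite outerE /N => Ni; rewrite !ifF //; lia. Qed.

Lemma outer0 i : i != l -> ~~ (p <= i < N)%N -> outer i = 0.
Proof. by rewrite outerE => /negbTE -> /negbTE ->. Qed.

Lemma extend_le i : `|x i| <= `|y i| + `|outer i|.
Proof.
rewrite outerE extendE; case: eqP => _; first by rewrite lerDr.
have [ip|pi] := ltnP i p; first by rewrite normr0 addr0.
by case: ifP => _; rewrite ?normr0 lerDr.
Qed.

Lemma l1_outer E : l1 (restr E outer) N = ((l \in E).*2 + (tail E) * 4)%:R * V.
Proof.
rewrite /l1 -(big_mkord xpredT (fun i => `|restr E outer i|)).
rewrite (@big_cat_nat _ _ _ p) //=; last by rewrite /N leq_addr.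
rewrite (@big_cat_nat _ _ _ l.+1) //=; last exact: ltnW.
rewrite big_nat_recr //= big1_seq ?add0r; last first.
  move=> i; rewrite mem_index_iota restrE => /= il.
  by rewrite outer0 ?if_same ?normr0 //; lia.
rewrite [X in _ + X + _]big1_seq ?addr0; last first.
  move=> i; rewrite mem_index_iota restrE => /= il.
  by rewrite outer0 ?if_same ?normr0 //; lia.
rewrite natrD mulrDl; congr (_ + _).
  rewrite restrE outerE eqxx; case: ifP => _; rewrite ?mul0r ?normr0 //=.
  by rewrite ger0_norm // mulr_ge0 // ler0n.
rewrite natrM natr_sum !mulr_suml; apply: eq_big_nat => i pi.
rewrite restrE outerE (_ : i == l = false) ?pi; last lia.
case: ifP => _; last by rewrite normr0 !mul0r.
by rewrite mul1r ger0_norm // mulr_ge0 // ler0n.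
Qed.

Lemma norm_y_le i : (0 < i)%N -> `|y i| <= V.
Proof.
by move=> i0; apply: le_trans (tnorm_le_tsirelson 0 y); exact: norm_le_tnorm.
Qed.

(** At positive levels a family sees [y], worth at most V in all, and the added part [outer], whose
    l_1 mass is halved by the factor 1/2 of the norm. *)
Lemma tnorm_restr_extend_le k E c :
  (forall i, (0 < i)%N -> i \in E -> `|x i| <= c) ->
  0 <= c -> V + 2^-1 * l1 (restr E outer) N <= c ->
  tnorm k (restr E x) <= c.
Proof.
move=> xc c0 lc; elim: k => [|k IH].
  by apply: tnorm0_le => i i0; rewrite restrE; case: ifP => iE; rewrite ?normr0 ?xc.
apply: tnormS_le => // s sA; apply: le_trans lc.
apply: (@le_trans _ _ (2^-1 * \sum_(F <- s)
    (tnorm k (restr F y) + l1 (restr F (restr E outer)) N))).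
  rewrite ler_pM2l ?invr_gt0 ?ltr0n //; apply: ler_sum => F _.
  apply: tnorm_le_sum => [i Ni|i i0]; first by rewrite 2!restrE outer_out // !if_same.
  rewrite (restrE F (restr E x)) (restrE F y) (restrE F (restr E outer)).
  rewrite (restrE E x) (restrE E outer).
  case: ifP => _; last by rewrite normr0 addr0.
  by case: ifP => _; [exact: extend_le|rewrite normr0 addr_ge0].
rewrite big_split mulrDr lerD //.
  exact: le_trans (le_tnormS k y sA) (tnorm_le_tsirelson _ _).
by rewrite ler_pM2l ?invr_gt0 ?ltr0n // sum_l1.
Qed.

Lemma tail0 E i : tail E = 0%N -> (p <= i < N)%N -> i \notin E.
Proof.
move=> tE pi; apply/negP => iE; move: tE; rewrite /tail.
by rewrite (bigD1_seq i) ?mem_index_iota ?iota_uniq //= iE.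
Qed.

(** With t = [tail E], half the mass of the added part is at most (1 + 2t)V, and [y] contributes
    another V. *)
Lemma tnorm_tail k E : (0 < tail E)%N ->
  tnorm k (restr E x) <= ((tail E).+1 * 2)%:R * V.
Proof.
move=> tE; have tV : V <= (tail E)%:R * V by rewrite ler_peMl // ler1n.
apply: tnorm_restr_extend_le; last 2 first.
- by rewrite mulr_ge0 ?ler0n.
- have : (l \in E)%:R * V <= V by case: (l \in E); rewrite ?mul1r ?mul0r.
  by rewrite l1_outer -muln2 natrD !natrM -[(tail E).+1]addn1 natrD; lra.
move=> i i0 _; have yi := norm_y_le i0; rewrite extendE natrM -[(tail E).+1]addn1 natrD.
case: ifP => _; [|case: ifP => _; [|case: ifP => _]].
- by rewrite ger0_norm ?mulr_ge0 ?ler0n //; move: tV V0; lra.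
- by move: yi tV V0; lra.
- by rewrite ger0_norm ?mulr_ge0 ?ler0n //; move: tV V0; lra.
- by rewrite normr0; move: tV V0; lra.
Qed.

Lemma tnorm_head k E : tail E = 0%N -> l \in E -> tnorm k (restr E x) <= 2 * V.
Proof.
move=> tE lE; apply: tnorm_restr_extend_le; last 2 first.
- by rewrite mulr_ge0 ?ler0n.
- by rewrite l1_outer tE lE (_ : (true.*2 + 0 * 4 = 2)%N) //; move: V0; lra.
move=> i i0 iE; have yi := norm_y_le i0; rewrite extendE.
case: ifP => _; first by rewrite ger0_norm ?mulr_ge0 ?ler0n.
have [ip|pi] := ltnP i p; first by move: yi V0; lra.
case: ifP => iN; last by rewrite normr0; move: V0; lra.
by have := tail0 tE (introT andP (conj pi iN)); rewrite iE.
Qed.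

Lemma tnorm_mid k E : tail E = 0%N -> l \notin E ->
  tnorm k (restr E x) <= tnorm k (restr E y).
Proof.
move=> tE lE; apply: tnorm_mono => i _; rewrite !restrE.
case: ifP => // iE; rewrite extendE; case: eqP => [il|_]; first by rewrite il (negbTE lE) in iE.
have [ip|pi] := ltnP i p; first exact: lexx.
case: ifP => iN; last by rewrite normr0.
by have := tail0 tE (introT andP (conj pi iN)); rewrite iE.
Qed.

Lemma sum_tail s : admissible s -> (\sum_(E <- s) tail E <= l - 2)%N.
Proof.
move=> sA; rewrite exchange_big /= -[leqRHS](_ : \sum_(p <= i < N) 1 = _)%N.
  by apply: leq_sum => i _; exact: admissible_count.
by rewrite sum_nat_const_nat muln1 /N; lia.
Qed.

(** The second bound sums the estimates of [tnorm_tail]; the first follows because each such member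
    has a tail point of its own. *)
Lemma sum_with_tail k s : admissible s ->
  \sum_(E <- s | (0 < tail E)%N) tnorm k (restr E x) <=
  (minn ((l - 2) * 4)
        (count (fun E => (0 < tail E)%N) s * 2 + (l - 2) * 2))%:R * V.
Proof.
move=> sA; set m := minn _ _.
apply: (@le_trans _ _
    ((\sum_(E <- s | (0 < tail E)%N) (tail E).+1 * 2)%N%:R * V)).
  by rewrite natr_sum mulr_suml; apply: ler_sum => E tE; exact: tnorm_tail.
rewrite ler_wpM2r // ler_nat -big_distrl /=.
rewrite (eq_bigr (fun E => 1 + tail E)%N) // big_split /= sum1_count.
have st : (\sum_(E <- s | (0 < tail E)%N) tail E <= l - 2)%N.
  apply: leq_trans (sum_tail sA).
  by rewrite [leqRHS](bigID (fun E => (0 < tail E)%N)) /= leq_addr.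
have : (count (fun E => (0 < tail E)%N) s <=
        \sum_(E <- s | (0 < tail E)%N) tail E)%N.
  by rewrite -sum1_count; apply: leq_sum.
by rewrite /m; move: st; clear; lia.
Qed.

(** At most one member contains [l], and the others see only [y]. For three or more members the sum
    over [y] is bounded only by 2V, a loss that [sum_extend] recovers from the tail. *)
Lemma sum_no_tail k s : admissible s ->
  \sum_(E <- s | tail E == 0%N) tnorm k (restr E x) <=
  if (count (fun E => tail E == 0%N) s <= 2)%N then 2 * V + tnorm k y
  else if has (fun E => l \in E) s then 4 * V else 2 * V.
Proof.
move=> sA; have yV := tnorm_le_tsirelson k y; have y0 := tnorm_ge0 k y.
rewrite -/V in yV.
pose u E := if l \in E then 2 * V else tnorm k (restr E y).
have le_u E : tail E == 0%N -> tnorm k (restr E x) <= u E.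
  by move=> /eqP tE; rewrite /u; case: ifP => [|/negbT]; [exact: tnorm_head|exact: tnorm_mid].
have le_uy E : u E <= if l \in E then 2 * V else tnorm k y.
  by rewrite /u; case: ifP => // _; exact: tnorm_restr.
apply: (le_trans (ler_sum _ le_u)).
case: ifP => [|_].
  rewrite -size_filter -big_filter.
  have : (\sum_(E <- [seq E <- s | tail E == 0%N]) (l \in E) <= 1)%N.
    apply: leq_trans (admissible_count l sA); rewrite big_filter.
    by rewrite [leqRHS](bigID (fun E => tail E == 0%N)) /= leq_addr.
  case: [seq E <- s | _] => [|A [|B [|//]]] /=.
  - by move=> _ _; rewrite big_nil; move: V0 y0; lra.
  - move=> _ _; rewrite big_seq1; apply: (le_trans (le_uy A)).
    by case: ifP => _; move: V0 y0 yV; lra.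
  - rewrite !big_cons !big_nil !addr0 addn0 => h _.
    apply: (le_trans (lerD (le_uy A) (le_uy B))); move: h.
    by case: (l \in A); case: (l \in B) => //= _; move: V0 y0 yV; lra.
have u0 E : 0 <= u E by rewrite /u; case: ifP => _; rewrite ?tnorm_ge0 ?mulr_ge0.
have sy : \sum_(E <- s) tnorm k (restr E y) <= 2 * V.
  have := le_trans (le_tnormS k y sA) (tnorm_le_tsirelson _ _).
  by rewrite -/V; lra.
apply: (@le_trans _ _ (\sum_(E <- s) u E)).
  rewrite [leRHS](bigID (fun E => tail E == 0%N)) /= lerDl.
  by apply: sumr_ge0 => E _.
have [_|/hasPn no] := boolP (has _ s); last first.
  apply: le_trans sy; rewrite big_seq [leRHS]big_seq; apply: ler_sum => E Es.
  by rewrite /u (negbTE (no _ Es)).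
apply: (@le_trans _ _ (\sum_(E <- s) ((l \in E)%:R * (2 * V) + tnorm k (restr E y)))).
  apply: ler_sum => E _; rewrite /u; case: ifP => _; rewrite ?mul1r ?mul0r ?add0r //.
  by rewrite lerDl tnorm_ge0.
rewrite big_split /= -mulr_suml -natr_sum.
have : (\sum_(E <- s) (l \in E))%N%:R * (2 * V) <= 2 * V.
  by rewrite ler_piMl ?mulr_ge0 // lern1 admissible_count.
by move: sy; lra.
Qed.

(* An admissible family with a member containing l has at most l members.  If
   three of them miss the l - 2 last points, then at most l - 3 meet these
   points: one point is missed or two share a member, at a cost of 2 V. *)
Lemma sum_extend k s : admissible s ->
  \sum_(E <- s) tnorm k (restr E x) <=
  2 * V + tnorm k y + ((l - 2) * 4)%:R * V.
Proof.
move=> sA; have y0 := tnorm_ge0 k y.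
rewrite (bigID (fun E => tail E == 0%N)) /=.
rewrite [X in _ + X](eq_bigl (fun E => (0 < tail E)%N)); last first.
  by move=> E; rewrite lt0n.
have := sum_no_tail k sA; have := sum_with_tail k sA; set m := minn _ _ => hQ hP.
have : m%:R * V <= ((l - 2) * 4)%:R * V by rewrite ler_wpM2r // ler_nat geq_minl.
move: hP; case: ifP => [_|c2]; first by move: hQ; lra.
case: ifP => [/hasP[E Es lE]|_]; last by move: hQ; lra.
move=> hP _; have : (m + 2)%:R * V <= ((l - 2) * 4)%:R * V.
  rewrite ler_wpM2r // ler_nat.
  have /admissibleP[_ _ _ /(_ _ _ Es lE)] := sA.
  rewrite -(count_predC (fun E => tail E == 0%N) s).
  rewrite (@eq_count _ (predC _) (fun E => 0 < tail E)%N); last first.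
    by move=> F /=; rewrite lt0n.
  by move: c2 l4; rewrite /m; clear; lia.
by rewrite natrD mulrDl; move: hP hQ; lra.
Qed.

(** [sum_extend] bounds every level from above, and one explicit family reaches the bound. Equality
    at each level carries the stabilization of [y] over to [x]. *)
Lemma tnorm_extend k :
  tnorm k.+1 x = 2^-1 * (2 * V + tnorm k y + ((l - 2) * 4)%:R * V).
Proof.
apply/eqP; rewrite eq_le; apply/andP; split.
  elim: k => [|k IH]; apply: tnormS_le => [|s sA];
    try by rewrite ler_pM2l ?invr_gt0 ?ltr0n // sum_extend.
    apply: tnorm0_le => i i0; have yi := norm_y_le i0; have := tnorm_ge0 0 y.
    (* As l >= 4, half of this is at least 4V, which bounds every coordinate. *)
    have : 8 * V <= ((l - 2) * 4)%:R * V.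
      by rewrite ler_wpM2r // (ler_nat _ 8); lia.
    rewrite extendE; case: ifP => _; [|case: ifP => _; [|case: ifP => _]] => h h'.
    - by rewrite ger0_norm ?mulr_ge0 ?ler0n //; move: V0; lra.
    - by move: V0; lra.
    - by rewrite ger0_norm ?mulr_ge0 ?ler0n //; move: V0; lra.
    - by rewrite normr0; move: V0; lra.
  apply: (le_trans IH); rewrite ler_pM2l ?invr_gt0 ?ltr0n // lerD2r lerD2l.
  exact: (le_tnorm y (leqnSn k)).
pose M := [fset i in iota l.+1 (p - l.+1)].
have inM i : (i \in M) = (l < i < p)%N.
  by rewrite /M inE mem_iota subnKC // ltnW.
have bM : block M.
  by apply/andP; split; [apply/fset0Pn; exists l.+1|]; rewrite inM ?ltn0 // leqnn.
have l0 : (0 < l)%N by lia.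
have bl := block1 l0; have [/andP[l1 _] /andP[M1 _]] := (bl, bM).
have p0 : (0 < p)%N by lia.
have lt_singles (A : {fset nat}) i : (forall j, j \in A -> (j < p)%N) -> A != fset0 ->
    (p <= i)%N -> fset_lt A [fset i].
  move=> Ap A0 pi; apply: fset_ltI => [//||a j /Ap aj].
    by apply/fset0Pn; exists i; rewrite inE.
  by rewrite inE => /eqP ->; exact: leq_trans pi.
(* Two blocks and l - 2 singletons make l members, as many as the minimum l allows. *)
have sA : admissible ([fset l] :: M :: singles p (l - 2)).
  apply/admissibleP; split=> //.
  - by rewrite /= bl bM block_singles.
  - rewrite /= pairwise_singles andbT -!andbA; apply/and3P; split.
    + by apply: fset_ltI => // i j; rewrite inE inM => /eqP -> /andP[].
    + apply/allP => E /singlesP[i /andP[pi _] ->]; apply: lt_singles => // j.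
      by rewrite inE => /eqP ->; lia.
    + apply/allP => E /singlesP[i /andP[pi _] ->]; apply: lt_singles => // j.
      by rewrite inM => /andP[].
  - move=> E i; rewrite /= size_map size_iota !inE => /or3P[/eqP->|/eqP->|].
    + by rewrite inE => /eqP ->; lia.
    + by rewrite inM; lia.
    + by move=> /singlesP[j jp ->]; rewrite inE => /eqP ->; lia.
apply: le_trans (le_tnormS k x sA); rewrite ler_pM2l ?invr_gt0 ?ltr0n //.
rewrite !big_cons addrA; apply: lerD; first apply: lerD.
- apply: le_trans (norm_le_tnorm k _ l0).
  by rewrite restrE inE eqxx extendE eqxx ger0_norm // mulr_ge0.
- apply: tnorm_mono => i _; rewrite restrE inM extendE.
  have [/ylp|/negbNE/eqP->] := boolP (y i != 0); last by rewrite normr0.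
  by move=> /andP[li ip]; rewrite li ip /= ifF //; lia.
- rewrite (_ : _%:R * V = 4 * V * (l - 2)%:R); last by rewrite natrM; ring.
  apply: sum_singles_ge => // i /andP[pi iN].
  rewrite extendE ifF ?ltnNge ?pi /=; last lia.
  by rewrite /N -ltnNge iN ger0_norm ?mulr_ge0 ?ler0n.
Qed.

(** Level k + 1 of [x] is a strictly increasing function of level [k] of [y]. *)
Lemma jstab_extend k : (k < jstab y)%N -> (k.+1 < jstab x)%N.
Proof.
rewrite !jstab_gt => ky; apply: lt_le_trans (tnorm_le_tsirelson (jstab y).+1 x).
rewrite !tnorm_extend (jstabP (leqnn (jstab y))) ltr_pM2l ?invr_gt0 ?ltr0n //.
by rewrite ltrD2r ltrD2l.
Qed.

End Extend.

(** * Iterated extension *)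

(** Three points starting at l + h are extended at l + h - 1, ..., l. Extending at a uses a - 1
    points, so p = l + h(l - 1) + h(h - 1)/2 + 3, doubled here to avoid division. *)
Lemma jstab_chain h l : (3 < l)%N -> exists y p,
  [/\ (p * 2 = l * 2 + h * 2 * l.-1 + h * h.-1 + 6)%N,
      forall i, y i != 0 -> (l <= i < p)%N & (h < jstab y)%N].
Proof.
elim: h l => [|h IH] l l3.
  have [y [yl yj]] := jstab_three (ltnW l3).
  by exists y, (l + 3)%N; split=> //; lia.
have [y [p [pE yl yj]]] := IH l.+1 (leqW l3).
have lp : (l.+1 < p)%N by move: pE; clear; nia.
exists (extend y l p), (p + (l - 2))%N; split.
- by move: l3 pE; case: l {IH yl lp} => [//|[//|l]] /= _; case: h {yj} => [|h] /=; nia.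
- move=> i; rewrite (extendE l3 lp yl); have [->|_] := eqVneq i l; first by lia.
  case: ifP => [ip /yl|pi]; first lia.
  by case: ifP => [iN _|]; [lia|rewrite eqxx].
- exact: jstab_extend.
Qed.

Lemma jstab_ge n : exists x : c00 R, [/\ x 0%N = 0,
  forall i, (n < i)%N -> x i = 0 & (2 * n <= (jstab x + 3) ^ 2)%N].
Proof.
(* Here 2n <= 8 is below 3^2, so the zero vector will do. *)
have [n5|n4] := leqP n 4.
  exists [fsfun]; split=> [|i _|]; rewrite ?fsfun0E //.
  by apply: (@leq_trans (3 ^ 2)); [lia|rewrite leq_exp2r // leq_addl].
have supp (y : c00 R) l p : (0 < l)%N -> (p <= n.+1)%N ->
    (forall i, y i != 0 -> (l <= i < p)%N) ->
    y 0%N = 0 /\ forall i, (n < i)%N -> y i = 0.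
  move=> l0 pn yl; split=> [|i ni]; apply/eqP; apply: contraT => /yl; lia.
(* For n = 5 the points 3, 4, 5 give a positive index, and 10 <= 4^2. *)
have [n5|n5] := leqP n 5.
  have [y [yl yj]] := @jstab_three 3 isT.
  have [||y0 yn] := supp y 3 6 _ _ yl => //.
  exists y; split=> //; apply: (@leq_trans (4 ^ 2)); first lia.
  by rewrite leq_exp2r // -[4%N]/(1 + 3)%N leq_add2r.
(* [P h] says that the chain started at l = 4 ends by [n]; h = 0 requires n >= 6. *)
pose P h := (h * h + 5 * h + 12 <= 2 * n)%N.
have P0 : exists h, P h by exists 0%N; rewrite /P; lia.
have Pn h : P h -> (h <= n)%N by rewrite /P; nia.
case: (ex_maxnP P0 Pn) => h Ph hmax.
have Ph1 : ~~ P h.+1 by apply/negP => /hmax; rewrite ltnn.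
have [y [p [pE yl yj]]] := @jstab_chain h 4 isT.
have [||y0 yn] := supp y 4 p _ _ yl => //.
  by move: pE Ph; rewrite /P; case: (h) => [|k] /=; nia.
exists y; split=> //; apply: (@leq_trans ((h + 4) ^ 2)).
  (* Maximality gives 2n <= h^2 + 7h + 17; parity lowers the constant to 16, so that (h + 4)^2
     suffices also for h = 0. *)
  have ev : odd (h * h + 7 * h) = false by rewrite oddD !oddM /=; case: (odd h).
  by move: Ph1; rewrite /P -mulnn; lia.
by rewrite leq_exp2r //; lia.
Qed.

End Lower.

(** * Existence of the maximum and passage to square roots *)

Theorem theorem1 (R : realType) (n : nat) (hn : (0 < n)%N) :
  exists J : nat, is_maximum (jset R n) J /\
    Num.sqrt (2 * n%:R) - 3 <= (J%:R : R) <= 2 * Num.sqrt n%:R + 4.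
Proof.
have [x [x0 xn xj]] := jstab_ge R n.
have le_J J : jset R n J -> ((J - 4) ^ 2 <= 4 * n)%N.
  by move=> [z [z0 zn] <-]; exact: jstab_sqr_le.
have exJ : exists J, `[< jset R n J >] by exists (jstab x); apply/asboolP; exists x.
have bdJ J : `[< jset R n J >] -> (J <= 4 * n + 4)%N.
  by move=> /asboolP/le_J; rewrite -mulnn; nia.
case: (ex_maxnP exJ bdJ) => J /asboolP JJ maxJ; exists J; split.
  by split=> // K KJ; apply: maxJ; apply/asboolP.
have xJ : (jstab x <= J)%N by apply: maxJ; apply/asboolP; exists x.
apply/andP; split.
  rewrite lerBlDr -natrD -(@ger0_norm _ (J + 3)%:R) ?ler0n // -sqrtr_sqr.
  rewrite ler_wsqrtr // -natrX -natrM ler_nat (leq_trans xj) //.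
  by rewrite leq_exp2r // leq_add2r.
(* The difference is truncated, but J <= (J - 4) + 4 holds in every case. *)
apply: (@le_trans _ _ ((J - 4)%:R + 4)).
  by rewrite -natrD ler_nat; lia.
rewrite lerD2r -(@ger0_norm _ (J - 4)%:R) ?ler0n // -sqrtr_sqr.
have -> : 2 * Num.sqrt n%:R = Num.sqrt (4 * n%:R) :> R.
  rewrite sqrtrM ?ler0n // (_ : 4 = 2 ^+ 2 :> R); last by rewrite -natrX.
  by rewrite sqrtr_sqr ger0_norm.
by rewrite ler_wsqrtr // -natrX -natrM ler_nat le_J.
Qed.
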